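(* Let $(D,\sigma)$ be a signed digraph. If $(D,\sigma)$ is switching-balanced, then \[ H_p^\sigma(D)\cong H_p(D)\qquad\text{for every }p\ge 0, \] where $H_p(D)$ is the ordinary real GLMY homology of $D$.
   Context: Signed digraphs. A signed digraph is a pair $(D,\sigma)$ where $D=(V,A)$ is a finite loopless digraph with at most one arrow from $i$ to $j$ for each ordered pair $(i,j)$, and $\sigma:A\to\{+1,-1\}$ is any function (antiparallel arrows are allowed and may have different signs). It is switching-balanced if there is $\eta:V\to\{+1,-1\}$ with $\sigma(ij)=\eta(i)\eta(j)$ for every arrow $i\to j$. Ordinary GLMY homology (real coefficients). For a finite loopless digraph $X$, an elementary $p$-path is a sequence $i_0\cdots i_p$ of vertices; it is regular if consecutive vertices are distinct, and allowed if $i_{r-1}\to i_r$ is an arrow for $1\le r\le p$. $\mathcal R_p(X)$ is the real vector space with basis $e_\gamma$, $\gamma$ a regular $p$-path (no arrow condition); $\mathcal A_p(X)\subseteq\mathcal R_p(X)$ is the span of the $e_\gamma$ with $\gamma$ allowed. For $p\ge1$, $\partial_p e_{i_0\cdots i_p}=\sum_{q=0}^p(-1)^q e_{i_0\cdots\widehat{i_q}\cdots i_p}$, nonregular terms being zero; $\partial_0=0$. Set $\Omega_0(X)=\mathcal A_0(X)$, $\Omega_p(X)=\{u\in\mathcal A_p(X):\partial_pu\in\mathcal A_{p-1}(X)\}$ for $p\ge1$, $\Omega_{-1}(X)=0$. These form a chain complex and $H_p(X)$ is its homology. Signed double cover. $\widetilde D_\sigma$ is the digraph with vertices $i^\varepsilon=(i,\varepsilon)\in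 V\times\{+1,-1\}$ and arrows $i^\varepsilon\to j^{\varepsilon\sigma(ij)}$ for each arrow $i\to j$ of $D$ and each $\varepsilon$. The deck involution is $\tau(i^\varepsilon)=i^{-\varepsilon}$, acting on paths vertexwise. Signed GLMY homology. $R_p^\sigma(D)$ is the quotient of $\mathcal R_p(\widetilde D_\sigma)$ by the span of all $e_{\tau\widetilde\gamma}+e_{\widetilde\gamma}$, $\widetilde\gamma$ a regular $p$-path on $V\times\{+1,-1\}$ (so $u^+u^-$ is regular, $u^+u^+$ is not). The boundary of $\mathcal R_\bullet(\widetilde D_\sigma)$ commutes with $\tau$ and induces $\partial^\sigma_{\mathrm{reg},p}:R_p^\sigma(D)\to R_{p-1}^\sigma(D)$ (zero for $p=0$). $\mathcal A_p^\sigma(D)\subseteq R_p^\sigma(D)$ is the span of the classes of allowed paths of $\widetilde D_\sigma$. Set $\Omega_0^\sigma(D)=\mathcal A_0^\sigma(D)$, $\Omega_p^\sigma(D)=\{z\in\mathcal A_p^\sigma(D):\partial^\sigma_{\mathrm{reg},p}z\in\mathcal A^\sigma_{p-1}(D)\}$ for $p\ge1$, $\Omega_{-1}^\sigma(D)=0$, and let $\partial_p^\sigma:\Omega_p^\sigma(D)\to\Omega_{p-1}^\sigma(D)$ be the restriction of $\partial^\sigma_{\mathrm{reg},p}$. $H_p^\sigma(D)$ is the homology of $(\Omega_\bullet^\sigma(D),\partial_*^\sigma)$. *)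

(* Defs.v *)
From HB Require Import structures.
From mathcomp Require Import all_boot all_order all_algebra.
From mathcomp Require Import generic_quotient ring_quotient.
Set Implicit Arguments.
Unset Strict Implicit.
Unset Printing Implicit Defensive.

Import GRing.Theory Quotient.
Local Open Scope ring_scope.
Local Open Scope quotient_scope.

Section QuotientSpace.
Variables (K : fieldType) (vT : vectType K) (U : {vspace vT}).

(* The quotient for the relation x - y \in U. *)
Definition vquot := {quot (pred_of_vspace U)}.
HB.instance Definition _ := ZmodQuotient.on vquot.

Definition vquot_scale (a : K) (z : vquot) : vquot := \pi_vquot (a *: repr z).

Lemma vquot_eqP (x y : vT) : reflect (\pi_vquot x = \pi_vquot y) (x - y \in U).
Proof.
rewrite (idealrBE (pred_of_vspace U)).
exact: eqP.
Qed.

Lemma vquot_reprP (x : vT) : x - repr (\pi_vquot x) \in U.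
Proof. by apply/vquot_eqP; rewrite reprK. Qed.

Lemma pi_vquotZ a x : \pi_vquot (a *: x) = vquot_scale a (\pi_vquot x).
Proof. by rewrite /vquot_scale; apply/vquot_eqP; rewrite -scalerBr rpredZ ?vquot_reprP. Qed.

Lemma pi_vquotD x y : \pi_vquot (x + y) = \pi_vquot x + \pi_vquot y :> vquot.
Proof. exact: (pi_add (pred_of_vspace U)). Qed.

Lemma vquot_scaleA a b z :
  vquot_scale a (vquot_scale b z) = vquot_scale (a * b) z.
Proof.
elim/quotW: z => z.
by rewrite -(pi_vquotZ b) -(pi_vquotZ a) -(pi_vquotZ (a * b)) scalerA.
Qed.

Lemma vquot_scale1 : left_id 1 vquot_scale.
Proof. by elim/quotW=> z; rewrite -pi_vquotZ scale1r. Qed.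

Lemma vquot_scaleDr : right_distributive vquot_scale +%R.
Proof.
move=> a; elim/quotW=> x; elim/quotW=> y; rewrite -pi_vquotD -!pi_vquotZ.
by rewrite scalerDr pi_vquotD.
Qed.

Lemma vquot_scaleDl z : {morph vquot_scale^~ z : a b / a + b}.
Proof.
by elim/quotW: z => z a b; rewrite -!pi_vquotZ scalerDl pi_vquotD.
Qed.

HB.instance Definition _ := GRing.Zmodule_isLmodule.Build K vquot
  vquot_scaleA vquot_scale1 vquot_scaleDr vquot_scaleDl.

Definition vquot_pi (x : vT) : vquot := \pi_vquot x.

Lemma vquot_pi_linear : linear vquot_pi.
Proof. by move=> a x y; rewrite /vquot_pi pi_vquotD pi_vquotZ. Qed.

Fact vquot_vect_iso : Vector.axiom (\dim (U^C)) vquot.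
Proof.
pose P := daddv_pi (U^C)%VS U.
have dUC : ((U^C) :&: U = 0)%VS by rewrite capvC capv_compl.
have kerP x : x - P x \in U.
  have xT : x \in ((U^C) + U)%VS by rewrite addvC addv_complf memvf.
  by rewrite -{1}(daddv_pi_add dUC xT) addrC addKr memv_pi.
have PU x : x \in U -> P x = 0.
  move=> xU; have : P x \in ((U^C) :&: U)%VS.
    by rewrite memv_cap memv_pi -[P x](subKr x) rpredB ?kerP.
  by rewrite dUC memv0 => /eqP.
have Prepr x : P (repr (\pi_vquot x)) = P x.
  apply/eqP; rewrite eq_sym -subr_eq0 -linearB /= PU //.
  exact: vquot_reprP.
pose b := vbasis (U^C)%VS.
pose f (z : vquot) : 'rV[K]_(\dim (U^C)) := \row_i coord b i (P (repr z)).
exists f.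
  move=> a; elim/quotW=> x; elim/quotW=> y; rewrite /f -vquot_pi_linear !Prepr.
  by apply/rowP=> i; rewrite !mxE !linearP.
exists (fun r : 'rV_(\dim (U^C)) => \pi_vquot (\sum_i r 0 i *: b`_i)).
  elim/quotW=> x; rewrite /f Prepr; under eq_bigr do rewrite mxE.
  rewrite -coord_vbasis ?memv_pi //.
  by apply/vquot_eqP; rewrite -opprB rpredN kerP.
move=> r; apply/rowP=> i; rewrite mxE Prepr daddv_pi_id //.
  by rewrite coord_sum_free ?(basis_free (vbasisP _)).
by apply: rpred_sum => j _; rewrite rpredZ ?vbasis_mem ?memt_nth.
Qed.

HB.instance Definition _ := Lmodule_hasFinDim.Build K vquot vquot_vect_iso.

HB.instance Definition _ :=
  GRing.isLinear.Build K vT vquot _ vquot_pi vquot_pi_linear.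

Definition vproj : 'Hom(vT, vquot) := linfun vquot_pi.

Lemma vprojE x : vproj x = \pi_vquot x.
Proof. by rewrite lfunE. Qed.

Lemma limg_vproj : limg vproj = fullv.
Proof.
apply/vspaceP; elim/quotW=> x; rewrite memvf -vprojE.
exact: memv_img (memvf _).
Qed.

End QuotientSpace.

(* The map vT / U -> wT / W induced by f: lift to vT (by any linear section),
   apply f, project. It is independent of the lift as soon as f maps U
   into W, see vquot_mapE. *)
Definition vquot_map (K : fieldType) (vT wT : vectType K)
    (U : {vspace vT}) (W : {vspace wT}) (f : 'Hom(vT, wT)) :
    'Hom(vquot U, vquot W) :=
  (vproj W \o f \o (vproj U)^-1)%VF.

Lemma vquot_mapE (K : fieldType) (vT wT : vectType K)
    (U : {vspace vT}) (W : {vspace wT}) (f : 'Hom(vT, wT)) (x : vT) :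
  (f @: U <= W)%VS -> vquot_map U W f (vproj U x) = vproj W (f x).
Proof.
move=> fUW; rewrite !comp_lfunE !vprojE; apply/vquot_eqP.
rewrite -linearB (subvP fUW) // memv_img //; apply/vquot_eqP.
by rewrite -!vprojE limg_lfunVK // limg_vproj memvf.
Qed.

(* Z / B; when B is not contained in Z this is Z / (Z :&: B). *)
Definition subquot (K : fieldType) (vT : vectType K) (Z B : {vspace vT}) :
    vectType K :=
  vquot (linfun (vsval : subvs_of Z -> vT) @^-1: B)%VS.

Definition isomorphic (K : fieldType) (vT wT : vectType K) : Prop :=
  exists f : {linear vT -> wT}, bijective f.

(* The homology of the largest subcomplex of (C, d) contained in the graded
   subspace A; d p goes from degree p.+1 to degree p, and the boundary in
   degree 0 is 0. *)
Section PathHomology.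
Variables (K : fieldType) (C : nat -> vectType K).
Variables (d : forall p, 'Hom(C p.+1, C p)) (A : forall p, {vspace C p}).

Definition Omega p : {vspace C p} :=
  match p with
  | 0 => A 0
  | q.+1 => (A q.+1 :&: d q @^-1: A q)%VS
  end.

Definition cycles p : {vspace C p} :=
  match p with
  | 0 => Omega 0
  | q.+1 => (Omega q.+1 :&: lker (d q))%VS
  end.

Definition boundaries p : {vspace C p} := (d p @: Omega p.+1)%VS.

Definition homology p : vectType K := subquot (cycles p) (boundaries p).

End PathHomology.

Record digraph := Digraph {
  vertex :> finType;
  arrow : rel vertex;
  arrow_irr : irreflexive arrow
}.

Section Chains.
Variables (K : fieldType) (X : digraph).

Definition regular p (s : p.+1.-tuple X) := sorted (fun x y => x != y) s.
Definition allowed p (s : p.+1.-tuple X) := sorted (@arrow X) s.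

Definition rpath p := {s : p.+1.-tuple X | regular s}.
HB.instance Definition _ p := SubFinite.on (rpath p).

Definition chain p := {ffun rpath p -> K^o}.
HB.instance Definition _ p := Vector.on (chain p).

(* e_s, which is 0 when s is not regular. *)
Definition elem p (s : p.+1.-tuple X) : chain p :=
  [ffun g : rpath p => (val g == s)%:R].

Definition face p (q : 'I_p.+2) (s : p.+2.-tuple X) : p.+1.-tuple X :=
  [tuple tnth s (lift q j) | j < p.+1].

Definition face_sum p (s : p.+2.-tuple X) : chain p :=
  \sum_(q < p.+2) (-1) ^+ q *: elem (face q s).

Definition bd_fun p (u : chain p.+1) : chain p :=
  \sum_(g : rpath p.+1) (u : {ffun _ -> K^o}) g *: face_sum (val g).

Lemma bd_fun_linear p : linear (@bd_fun p).
Proof.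
move=> a u v; rewrite /bd_fun scaler_sumr -big_split /=.
by apply: eq_bigr => g _; rewrite !ffunE scalerDl scalerA.
Qed.

HB.instance Definition _ p :=
  GRing.isLinear.Build K (chain p.+1) (chain p) _ (@bd_fun p)
    (@bd_fun_linear p).

Definition bd p : 'Hom(chain p.+1, chain p) := linfun (@bd_fun p).

Lemma bd_elem p (s : p.+2.-tuple X) : regular s -> bd p (elem s) = face_sum s.
Proof.
move=> rs; rewrite lfunE /= /bd_fun (bigD1 (Sub s rs)) //= ffunE eqxx scale1r.
rewrite big1 ?addr0 // => g; rewrite ffunE -val_eqE /= => /negPf->.
by rewrite scale0r.
Qed.

Definition achain p : {vspace chain p} :=
  span [seq elem s | s in @allowed p].

End Chains.

Definition glmy_homology (K : fieldType) (X : digraph) (p : nat) :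
    vectType K :=
  homology (@bd K X) (@achain K X) p.

(* A sign is a boolean b standing for (-1) ^+ b, so the product of signs is
   addb. A signature is a total function D -> D -> bool of which only the
   values on arrows are used. *)

Definition switching_balanced (D : digraph) (sigma : D -> D -> bool) : Prop :=
  exists eta : D -> bool,
    forall i j : D, arrow i j -> sigma i j = eta i (+) eta j.

Section Signed.
Variables (K : fieldType) (D : digraph) (sigma : D -> D -> bool).

Definition cover_arrow : rel (D * bool)%type :=
  fun x y => arrow x.1 y.1 && (y.2 == x.2 (+) sigma x.1 y.1).

Lemma cover_arrow_irr : irreflexive cover_arrow.
Proof. by move=> x; rewrite /cover_arrow arrow_irr. Qed.

Definition double_cover : digraph := Digraph cover_arrow_irr.

Definition deck (x : double_cover) : double_cover := (x.1, ~~ x.2).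

Definition antideck p : {vspace chain K double_cover p} :=
  span [seq elem K (map_tuple deck s) + elem K s
         | s in @regular double_cover p].

Definition schain p := vquot (antideck p).
HB.instance Definition _ p := Vector.on (schain p).

Definition sbd p : 'Hom(schain p.+1, schain p) :=
  vquot_map (antideck p.+1) (antideck p) (bd K double_cover p).

Definition aschain p : {vspace schain p} :=
  span [seq vproj (antideck p) (elem K s) | s in @allowed double_cover p].

Lemma deckK : involutive deck.
Proof. by case=> x b; rewrite /deck /= negbK. Qed.

Lemma regular_deck p (s : p.+1.-tuple double_cover) :
  regular (map_tuple deck s) = regular s.
Proof.
rewrite /regular /= sorted_map; case: (val s) => //= x t.
by apply: eq_path => y z /=; rewrite (inj_eq (inv_inj deckK)).
Qed.

Lemma elem_nreg p (s : p.+1.-tuple double_cover) :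
  ~~ regular s -> elem K s = 0.
Proof.
move=> ns; apply/ffunP=> g; rewrite !ffunE; case: eqP => // gs.
by case/negP: ns; rewrite -gs (valP g).
Qed.

Lemma antideckP p (s : p.+1.-tuple double_cover) :
  elem K (map_tuple deck s) + elem K s \in antideck p.
Proof.
have [rs|ns] := boolP (regular s); last first.
  by rewrite !elem_nreg ?addr0 ?mem0v ?regular_deck.
by apply/memv_span/imageP; exists s.
Qed.

Lemma face_deck p (q : 'I_p.+2) (s : p.+2.-tuple double_cover) :
  face q (map_tuple deck s) = map_tuple deck (face q s).
Proof. by apply: eq_from_tnth => j; rewrite !(tnth_mktuple, tnth_map). Qed.

Lemma bd_antideck p : (bd K double_cover p @: antideck p.+1 <= antideck p)%VS.
Proof.
rewrite limg_span; apply/span_subvP=> _ /mapP[_ /imageP[s rs ->] ->].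
rewrite linearD /= !bd_elem ?regular_deck // /face_sum -big_split /=.
apply: rpred_sum => q _; rewrite -scalerDr rpredZ // face_deck.
exact: antideckP.
Qed.

Lemma sbd_proj p (u : chain K double_cover p.+1) :
  sbd p (vproj (antideck p.+1) u) =
  vproj (antideck p) (bd K double_cover p u).
Proof. exact: vquot_mapE (bd_antideck p). Qed.

End Signed.

Definition signed_homology (K : fieldType) (D : digraph)
    (sigma : D -> D -> bool) (p : nat) : vectType K :=
  homology (@sbd K D sigma) (@aschain K D sigma) p.

(* Main.v *)
(* If eta witnesses the balance, then i |-> (i, eta i) embeds D in the double
   cover, and each allowed path of the cover is the lift of an allowed path of D
   or the deck translate of such a lift. The induced chain map to the signed
   chains is injective and sends allowed chains onto allowed chains, hence
   restricts to an isomorphism of the Omega complexes. It is not onto in general: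
   the class of u^+ u^- is a regular signed path without counterpart in D. *)

From HB Require Import structures.
Require Import Defs.
From mathcomp Require Import all_boot all_algebra reals.

Set Implicit Arguments.
Unset Strict Implicit.
Unset Printing Implicit Defensive.

Import GRing.Theory VectorInternalTheory.
Local Open Scope ring_scope.

(** * Dimensions of subquotients and images of preimages *)

Lemma isomorphic_dim (K : fieldType) (vT wT : vectType K) :
  dim vT = dim wT -> isomorphic vT wT.
Proof.
(* Equality of dimensions is eliminated for row spaces with variable sizes [m] and [n], where one
   can be substituted for the other; coordinates then transport the result. *)
have rV_iso m n : m = n -> exists g : {linear 'rV[K]_m -> 'rV[K]_n}, bijective g.
  by move=> <-; exists idfun; exists id.
move=> /rV_iso[g g_bij].
exists (r2v \o (g \o v2r) : {linear vT -> wT}).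
apply: bij_comp; first by exists v2r; [exact: r2vK|exact: v2rK].
by apply: bij_comp => //; exists r2v; [exact: v2rK|exact: r2vK].
Qed.

Lemma vproj_eq0 (K : fieldType) (vT : vectType K) (U : {vspace vT}) (x : vT) :
  (vproj U x == 0) = (x \in U).
Proof.
have -> : 0 = vproj U 0 by rewrite linear0.
by rewrite !vprojE -[x in RHS]subr0; apply/eqP/vquot_eqP.
Qed.

Lemma dim_subquot (K : fieldType) (vT : vectType K) (Z B : {vspace vT}) :
  dim (subquot Z B) = (\dim Z - \dim (Z :&: B))%N.
Proof.
pose i : 'Hom(subvs_of Z, vT) := linfun vsval.
have i_inj : lker i == 0%VS.
  by apply/lker0P => x y; rewrite !lfunE /=; apply: val_inj.
have limg_i : limg i = Z.
  apply/vspaceP => x; apply/memv_imgP/idP => [[y _ ->]|xZ].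
    by rewrite lfunE; exact: subvsP.
  by exists (vsproj Z x); rewrite ?memvf // lfunE /= vsprojK.
(* True by computation: the quotient was given coordinates along a complement. *)
have -> : dim (subquot Z B) = \dim (i @^-1: B)^C by [].
rewrite dimv_compl -(limg_dim_eq (f := i) (U := fullv)); last first.
  by rewrite (eqP i_inj) capv0.
rewrite -(limg_dim_eq (f := i) (U := (i @^-1: B)%VS)); last first.
  by rewrite (eqP i_inj) capv0.
by rewrite limg_i -lpreim_cap_limg lpreimK ?capvSr // limg_i capvC.
Qed.

(** An injective map preserves the dimensions of [Z] and of [Z :&: B], which determine the
    subquotient up to isomorphism. *)
Lemma isomorphic_subquot_limg (K : fieldType) (vT wT : vectType K)
    (f : 'Hom(vT, wT)) (Z B : {vspace vT}) :
  lker f == 0%VS -> isomorphic (subquot (f @: Z) (f @: B)) (subquot Z B).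
Proof.
move=> f_inj; apply: isomorphic_dim; rewrite !dim_subquot -lker0_img_cap //.
by rewrite !limg_dim_eq // (eqP f_inj) capv0.
Qed.

(** Injectivity of [g] turns [g (h u) \in g @: W] into [h u \in W]. Taking for [W] the allowed
    chains handles [Omega]; taking [0] handles cycles. *)
Lemma limg_cap_preim (K : fieldType) (vT wT vT' wT' : vectType K)
    (f : 'Hom(vT, vT')) (g : 'Hom(wT, wT')) (h : 'Hom(vT, wT))
    (h' : 'Hom(vT', wT')) (U : {vspace vT}) (W : {vspace wT}) :
  lker g == 0%VS -> (forall u, h' (f u) = g (h u)) ->
  (f @: (U :&: h @^-1: W) = f @: U :&: h' @^-1: (g @: W))%VS.
Proof.
move=> /lker0P g_inj comm; apply/vspaceP => z; apply/memv_imgP/memv_capP.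
  case=> u /memv_capP[uU]; rewrite -memv_preim => huW ->.
  by rewrite memv_img // -memv_preim comm memv_img.
case=> /memv_imgP[u uU ->]; rewrite -memv_preim comm.
case/memv_imgP=> w wW /g_inj huw; exists u => //.
by rewrite memv_cap uU -memv_preim huw.
Qed.

(** * Injective chain maps that match the allowed subspaces *)

Section PathHomologyMap.
Variables (K : fieldType) (C C' : nat -> vectType K).
Variables (d : forall p, 'Hom(C p.+1, C p)) (d' : forall p, 'Hom(C' p.+1, C' p)).
Variables (A : forall p, {vspace C p}) (A' : forall p, {vspace C' p}).
Variable f : forall p, 'Hom(C p, C' p).
Hypothesis f_inj : forall p, lker (f p) == 0%VS.
Hypothesis f_comm : forall p u, d' p (f p.+1 u) = f p (d p u).
Hypothesis f_limg : forall p, (f p @: A p)%VS = A' p.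

Lemma limg_Omega p : (f p @: Omega d A p)%VS = Omega d' A' p.
Proof.
case: p => [|p] /=; first exact: f_limg.
by rewrite (limg_cap_preim _ _ (f_inj p) (@f_comm p)) !f_limg.
Qed.

Lemma limg_cycles p : (f p @: cycles d A p)%VS = cycles d' A' p.
Proof.
case: p => [|p]; first exact: limg_Omega.
(* The kernel is read as the preimage of [0]. *)
rewrite /cycles -!lpreim0 (limg_cap_preim _ _ (f_inj p) (@f_comm p)).
by rewrite limg_Omega limg0.
Qed.

Lemma limg_boundaries p : (f p @: boundaries d A p)%VS = boundaries d' A' p.
Proof.
rewrite /boundaries -limg_Omega -!limg_comp; congr (_ @: _)%VS.
by apply/lfunP => u; rewrite !comp_lfunE f_comm.
Qed.

Lemma isomorphic_homology p : isomorphic (homology d' A' p) (homology d A p).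
Proof.
rewrite /homology -limg_cycles -limg_boundaries.
exact: isomorphic_subquot_limg.
Qed.

End PathHomologyMap.

(** * Pushing regular chains forward along an injective vertex map *)

Section Pushforward.
Variables (K : fieldType) (X Y : digraph) (f : X -> Y).
Hypothesis f_inj : injective f.

Lemma regular_map_inj p (s : p.+1.-tuple X) : regular (map_tuple f s) = regular s.
Proof.
rewrite /regular /= sorted_map; case: (val s) => //= x t.
by apply: eq_path => y z /=; rewrite (inj_eq f_inj).
Qed.

Lemma face_map p (q : 'I_p.+2) (s : p.+2.-tuple X) :
  face q (map_tuple f s) = map_tuple f (face q s).
Proof. by apply: eq_from_tnth => j; rewrite !(tnth_mktuple, tnth_map). Qed.

Definition push_fun p (u : chain K X p) : chain K Y p :=
  \sum_(g : rpath X p) (u : {ffun _ -> K^o}) g *: elem K (map_tuple f (val g)).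

Lemma push_fun_linear p : linear (@push_fun p).
Proof.
move=> a u v; rewrite /push_fun scaler_sumr -big_split /=.
by apply: eq_bigr => g _; rewrite !ffunE scalerDl scalerA.
Qed.

HB.instance Definition _ p :=
  GRing.isLinear.Build K (chain K X p) (chain K Y p) _ (@push_fun p)
    (@push_fun_linear p).

Definition push p : 'Hom(chain K X p, chain K Y p) := linfun (@push_fun p).

Lemma elem_nonregular (Z : digraph) p (s : p.+1.-tuple Z) :
  ~~ regular s -> elem K s = 0.
Proof.
move=> ns; apply/ffunP=> g; rewrite !ffunE; case: eqP => // gs.
by case/negP: ns; rewrite -gs (valP g).
Qed.

(** Nonregular tuples are covered as well, since faces of regular paths may be nonregular;
    injectivity of [f] makes both sides vanish together. *)
Lemma push_elem p (s : p.+1.-tuple X) : push p (elem K s) = elem K (map_tuple f s).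
Proof.
have [rs|ns] := boolP (regular s); last first.
  by rewrite !elem_nonregular ?linear0 ?regular_map_inj.
rewrite lfunE /= /push_fun (bigD1 (Sub s rs)) //= ffunE eqxx scale1r.
rewrite big1 ?addr0 // => g; rewrite ffunE -val_eqE /= => /negPf->.
by rewrite scale0r.
Qed.

Lemma push_bd p (u : chain K X p.+1) : bd K Y p (push p.+1 u) = push p (bd K X p u).
Proof.
rewrite [push _ u]lfunE [bd K X p u]lfunE /= /push_fun /bd_fun !linear_sum /=.
apply: eq_bigr => g _; rewrite !linearZ /= bd_elem ?regular_map_inj ?(valP g) //.
congr (_ *: _); rewrite /face_sum linear_sum; apply: eq_bigr => q _.
by rewrite linearZ /= push_elem face_map.
Qed.

Lemma push_coef p (u : chain K X p) (t : rpath Y p) :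
  (push p u : {ffun _ -> K^o}) t =
  \sum_(g : rpath X p) (u : {ffun _ -> K^o}) g * (val t == map_tuple f (val g))%:R.
Proof.
rewrite lfunE /= /push_fun sum_ffunE; apply: eq_bigr => g _.
by rewrite !ffunE.
Qed.

End Pushforward.

(** * The sheet of the double cover cut out by a switching function *)

Section Signed.
Variables (K : fieldType) (D : digraph) (sigma : D -> D -> bool).
Let cover := double_cover sigma.

(** The difference of the two coefficients is a linear form. It kills every generator, because the
    deck involution merely swaps the two terms. *)
Lemma antideck_deck p (v : chain K cover p) (t t' : rpath cover p) :
  v \in antideck K sigma p -> val t' = map_tuple (@deck _ sigma) (val t) ->
  (v : {ffun _ -> K^o}) t' = (v : {ffun _ -> K^o}) t.
Proof.
move=> vU tt'; pose c (w : chain K cover p) : K^o :=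
  (w : {ffun _ -> K^o}) t' - (w : {ffun _ -> K^o}) t.
have c_lin : linear c.
  by move=> a x y; rewrite /c !ffunE scalerBr opprD addrACA.
pose cL := HB.pack_for {linear chain K cover p -> K^o} c
  (GRing.isLinear.Build K _ _ _ c c_lin).
suff /subvP/(_ _ vU) : (antideck K sigma p <= lker (linfun cL))%VS.
  by rewrite memv_ker lfunE /= /c subr_eq0 => /eqP.
have dK : involutive (map_tuple (@deck _ sigma) : p.+1.-tuple cover -> _).
  by move=> s; apply: val_inj; rewrite /= (mapK (@deckK _ sigma)).
apply/span_subvP => _ /imageP[s _ ->].
rewrite memv_ker lfunE /= /c !ffunE tt' !(inv_eq dK) dK.
by rewrite [X in X - _]addrC subrr.
Qed.

Variable eta : D -> bool.

Definition sheet (i : D) : cover := (i, eta i).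

Lemma sheet_inj : injective sheet.
Proof. by move=> i j []. Qed.

(** The sheet and its deck translate are disjoint: a common vertex [j] would give
    [eta j = ~~ eta j]. *)
Lemma sheet_deck (i j : D) : deck (sheet i) != sheet j.
Proof. by apply/eqP => -[->]; case: (eta j). Qed.

Definition sheet_map p : 'Hom(chain K D p, schain K sigma p) :=
  (vproj (antideck K sigma p) \o push K sheet p)%VF.

Lemma sheet_mapE p (u : chain K D p) :
  sheet_map p u = vproj (antideck K sigma p) (push K sheet p u).
Proof. exact: comp_lfunE. Qed.

Lemma sheet_map_elem p (s : p.+1.-tuple D) :
  sheet_map p (elem K s) = vproj (antideck K sigma p) (elem K (map_tuple sheet s)).
Proof. by rewrite sheet_mapE push_elem //; exact: sheet_inj. Qed.

Lemma sheet_map_bd p (u : chain K D p.+1) :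
  sbd K sigma p (sheet_map p.+1 u) = sheet_map p (bd K D p u).
Proof. by rewrite !sheet_mapE sbd_proj push_bd //; exact: sheet_inj. Qed.

(* A chain supported on the sheet vanishes on its deck translate, while a
   chain in [antideck] is deck-invariant. *)
Lemma sheet_map_inj p : lker (sheet_map p) == 0%VS.
Proof.
rewrite -subv0; apply/subvP => u; rewrite memv_ker sheet_mapE memv0.
rewrite vproj_eq0 => pushU; apply/eqP/ffunP => g; rewrite ffunE.
have rt : regular (map_tuple sheet (val g)).
  by rewrite regular_map_inj ?(valP g) //; exact: sheet_inj.
have rt' : regular (map_tuple (@deck _ sigma) (map_tuple sheet (val g))).
  by rewrite regular_deck.
pose t : rpath cover p := Sub _ rt; pose t' : rpath cover p := Sub _ rt'.
have := antideck_deck (t := t) (t' := t') pushU erefl.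
(* First vertices alone rule out every term at [t']; at [t], injectivity of [sheet] leaves only the
   coefficient of [g]. *)
rewrite !push_coef /= big1 => [|h _]; last first.
  case: eqP => [/(congr1 (@thead _ _))|]; last by rewrite mulr0.
  by rewrite /thead !tnth_map => /eqP; rewrite (negPf (sheet_deck _ _)).
rewrite (bigD1 g) //= eqxx mulr1 big1 ?addr0 // => h; rewrite -val_eqE => hg.
case: eqP => [/(congr1 val)/(inj_map sheet_inj) gh|]; last by rewrite mulr0.
by case/eqP: hg; apply: val_inj.
Qed.

Hypothesis etaP : forall i j : D, arrow i j -> sigma i j = eta i (+) eta j.

(** By balance, the arrow of the cover leaving [(i, eta i)] over [i -> j] ends at sign
    [eta i (+) sigma i j = eta j], hence stays on the sheet. *)
Lemma allowed_sheet p (s : p.+1.-tuple D) :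
  allowed (map_tuple sheet s : p.+1.-tuple cover) = allowed s.
Proof.
rewrite /allowed /= sorted_map; case: (val s) => //= x t.
apply: eq_path => y z /=; rewrite /cover_arrow /=.
by case: (boolP (arrow y z)) => //= /etaP->; rewrite addKb eqxx.
Qed.

Lemma allowed_cover p (s : p.+1.-tuple cover) : allowed s ->
  exists2 s0 : p.+1.-tuple D, allowed s0 &
    s = map_tuple sheet s0 \/ s = map_tuple (@deck _ sigma) (map_tuple sheet s0).
Proof.
(* The quantity [y.2 (+) eta y.1] is constant along an allowed path and tells which of the two
   sheets contains it. *)
have path_sheet (x : cover) t : path (@arrow cover) x t ->
    all (fun y : cover => y.2 (+) eta y.1 == x.2 (+) eta x.1) t.
  elim: t x => //= y t IHt x /andP[/andP[xy /eqP y2] /IHt].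
  rewrite y2 (etaP xy); have -> : x.2 (+) (eta x.1 (+) eta y.1) (+) eta y.1
    = x.2 (+) eta x.1 by rewrite !addbA addbK.
  by rewrite eqxx.
move=> as_; pose s0 : p.+1.-tuple D := map_tuple fst s.
pose b := (thead s).2 (+) eta (thead s).1.
have sE : s = map_tuple (fun i : D => (i, eta i (+) b) : cover) s0.
  have /allP sb : all (fun y : cover => y.2 (+) eta y.1 == b) s.
    move: as_; rewrite /b; case/tupleP: s @s0 @b => x t _ _ /=.
    by rewrite theadE eqxx /allowed /= => /path_sheet.
  apply: eq_from_tnth => i; rewrite !tnth_map.
  have /eqP <- := sb _ (mem_tnth i s).
  by case: (tnth s i) => x c /=; rewrite addbC addbK.
exists s0.
  move: as_; rewrite /allowed /= sorted_map; case: (val s) => //= x t.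
  by apply: sub_path => y z /andP[].
rewrite sE; case: b {sE}; [right|left]; apply: eq_from_tnth => i;
  by rewrite !tnth_map ?addbT ?addbF.
Qed.

Lemma limg_sheet_map p : (sheet_map p @: achain K D p)%VS = aschain K sigma p.
Proof.
apply/eqP; rewrite eqEsubv; apply/andP; split.
  rewrite limg_span; apply/span_subvP=> _ /mapP[_ /imageP[s as_ ->] ->].
  rewrite sheet_map_elem; apply/memv_span/imageP.
  by exists (map_tuple sheet s) => //; exact: etrans (allowed_sheet s) as_.
apply/span_subvP=> _ /imageP[s /allowed_cover[s0 as0 sE] ->].
have elem_s0 : elem K s0 \in achain K D p.
  by apply/memv_span/imageP; exists s0.
have := memv_img (sheet_map p) elem_s0; rewrite sheet_map_elem.
case: sE => -> //; set t := map_tuple sheet s0 => tA.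
(* In the quotient the class of the deck translate of [t] is minus the class of [t], which is
   already known to lie in the image. *)
rewrite -[vproj _ _](addrK (vproj (antideck K sigma p) (elem K t))) -linearD /=.
rewrite rpredB //.
suff /eqP -> : vproj (antideck K sigma p)
    (elem K (map_tuple (@deck _ sigma) t) + elem K t) == 0 by exact: mem0v.
by rewrite vproj_eq0 antideckP.
Qed.

End Signed.

Theorem corollary3p13 (R : realType) (D : digraph) (sigma : D -> D -> bool) :
  switching_balanced sigma ->
  forall p : nat,
    isomorphic (signed_homology R sigma p) (glmy_homology R D p).
Proof.
case=> eta etaP p.
apply: (@isomorphic_homology R _ _ _ _ _ _ (sheet_map R sigma eta)).
- exact: sheet_map_inj.
- exact: sheet_map_bd.
(* Balance enters here, through [etaP]. *)
- exact: limg_sheet_map.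
Qed.
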